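(* Let $n\ge 2$ be an integer. If the graph $T_{n+1}$ is SPN, then the complete bipartite graph $K_{2,n}$ is SPN.
   Context: A real symmetric $m\times m$ matrix $A$ is copositive if $x^TAx\ge 0$ for every entrywise nonnegative vector $x\in\mathbb{R}^m$. A real symmetric matrix $A$ is an SPN matrix if $A=P+N$, where $P$ is a real symmetric positive semidefinite matrix and $N$ is a symmetric entrywise nonnegative matrix. For a real symmetric $m\times m$ matrix $A=(a_{ij})$, the graph $G(A)$ is the simple undirected graph with vertex set $\{1,\dots,m\}$ in which distinct vertices $i,j$ are adjacent if and only if $a_{ij}\neq 0$ (no condition is imposed on the diagonal entries). A simple graph $G$ is called an SPN graph (or simply SPN) if every copositive matrix $A$ whose graph $G(A)$ is (isomorphic to) $G$ is an SPN matrix. For an integer $m\ge 3$, $T_m$ denotes the graph on $m$ vertices consisting of $m-2$ triangles sharing a common base; that is, it has two adjacent vertices together with $m-2$ further pairwise non-adjacent vertices, each of which is adjacent to both of the first two. $K_{2,n}$ denotes the complete bipartite graph with parts of sizes $2$ and $n$. *)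

(* Defs.v *)
From mathcomp Require Import all_boot all_order all_algebra.
From mathcomp Require Import reals.

Set Implicit Arguments.
Unset Strict Implicit.
Unset Printing Implicit Defensive.

Import Order.TTheory GRing.Theory Num.Theory.
Local Open Scope ring_scope.

Definition qform (R : realType) (m : nat) (A : 'M[R]_m) (x : 'cV[R]_m) : R :=
  (x^T *m A *m x) 0 0.

Definition copositive (R : realType) (m : nat) (A : 'M[R]_m) : Prop :=
  A \is symmetricmx
  /\ forall x : 'cV[R]_m, x \is a mxOver Num.nneg -> 0 <= qform A x.

Definition psd (R : realType) (m : nat) (P : 'M[R]_m) : Prop :=
  P \is symmetricmx /\ forall x : 'cV[R]_m, 0 <= qform P x.

Definition spn_matrix (R : realType) (m : nat) (A : 'M[R]_m) : Prop :=
  exists P N : 'M[R]_m,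
    [/\ psd P, N \is symmetricmx, N \is a mxOver Num.nneg & A = P + N].

(* A graph is given by its adjacency relation on a finite type; it is simple
   when this relation is symmetric and irreflexive. *)
Definition simple_graph (V : finType) (e : rel V) : Prop :=
  symmetric e /\ irreflexive e.

Definition graph_iso (V W : finType) (e : rel V) (f : rel W) : Prop :=
  exists h : V -> W, bijective h /\ forall x y, f (h x) (h y) = e x y.

Definition mxgraph (R : realType) (m : nat) (A : 'M[R]_m) : rel 'I_m :=
  fun i j => (i != j) && (A i j != 0).

(* Meant for simple graphs e: copositive matrices are symmetric, so their
   graphs are simple, and the condition is vacuous for any other relation. *)
Definition spn_graph (R : realType) (V : finType) (e : rel V) : Prop :=
  forall (m : nat) (A : 'M[R]_m),
    copositive A -> graph_iso (mxgraph A) e -> spn_matrix A.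

(* For m >= 3: vertices 0 and 1 form the common base of the m - 2 triangles. *)
Definition T_graph (m : nat) : rel 'I_m :=
  fun i j => (i != j) && ((i < 2)%N || (j < 2)%N).

Definition complete_bipartite (p q : nat) : rel ('I_p + 'I_q)%type :=
  fun u v => match u, v with
             | inl _, inr _ | inr _, inl _ => true
             | _, _ => false
             end.

Lemma symmetricmxP (R : realType) (m : nat) (A : 'M[R]_m) :
  reflect (A^T = A) (A \is symmetricmx).
Proof.
rewrite is_hermitianmxE expr0 scale1r map_mx_id // eq_sym.
exact: eqP.
Qed.

Lemma mxgraph_simple (R : realType) (m : nat) (A : 'M[R]_m) :
  A \is symmetricmx -> simple_graph (mxgraph A).
Proof.
move=> /symmetricmxP symA; split=> [i j | i]; rewrite /mxgraph ?eqxx // eq_sym.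
by rewrite -[in LHS]symA mxE.
Qed.

Lemma T_graph_simple (m : nat) : simple_graph (@T_graph m).
Proof.
by split=> [i j | i]; rewrite /T_graph ?eqxx // eq_sym orbC.
Qed.

Lemma complete_bipartite_simple (p q : nat) :
  simple_graph (@complete_bipartite p q).
Proof. by split=> [[i|i] [j|j] | [i|i]]. Qed.

(* Main.v *)
(** Let u, v be the part of size 2 of K_{2,n}.  If some w in the other part has
    both its entries A w u and A w v negative, then A w w > 0 and the Schur
    complement of A w w in A is copositive, because row w is nonpositive off the
    diagonal; its graph is T_{n+1}, as the fill-in at u, v is nonzero.  An SPN
    decomposition of it plus a rank one psd matrix decomposes A.  Otherwise the
    negative off-diagonal entries of A form two disjoint stars centred at u
    and v, and zeroing the entries between distinct stars leaves a block diagonal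
    matrix whose blocks are copositive with nonpositive off-diagonal entries,
    hence psd. *)
Require Import Defs.
From mathcomp Require Import all_boot all_order all_algebra.
From mathcomp Require Import reals.
From mathcomp Require Import zify ring lra.

Set Implicit Arguments.
Unset Strict Implicit.
Unset Printing Implicit Defensive.

Import Order.TTheory GRing.Theory Num.Theory.
Local Open Scope ring_scope.

(** * Quadratic forms and copositive matrices *)

Lemma qformE (R : realType) (m : nat) (A : 'M[R]_m) (x : 'cV[R]_m) :
  qform A x = \sum_i \sum_j x i 0 * A i j * x j 0.
Proof.
rewrite /qform mxE exchange_big; apply: eq_bigr => j _ /=.
by rewrite !mxE mulr_suml; apply: eq_bigr => i _; rewrite !mxE.
Qed.

Lemma qformD (R : realType) (m : nat) (A B : 'M[R]_m) (x : 'cV[R]_m) :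
  qform (A + B) x = qform A x + qform B x.
Proof. by rewrite /qform mulmxDr mulmxDl mxE. Qed.

Lemma symmetricmx_entryP (R : realType) (m : nat) (A : 'M[R]_m) :
  A \is symmetricmx <-> forall i j, A i j = A j i.
Proof.
split=> [/symmetricmxP sA i j|sA]; first by rewrite -{1}sA mxE.
by apply/symmetricmxP/matrixP => i j; rewrite mxE.
Qed.

(** On the vectors [s e_i + t e_j] with [A i i = 0], the form is affine in [s] with negative slope
    [2 t A i j], so it becomes negative for large [s]. *)
Lemma copositive_diag_gt0 (R : realType) (m : nat) (A : 'M[R]_m) (i j : 'I_m) :
  copositive A -> A i j < 0 -> 0 < A i i.
Proof.
move=> [/symmetricmx_entryP sA cA] Aij.
have E (s t : R) : 0 <= s -> 0 <= t ->
    0 <= s * s * A i i + 2 * s * t * A i j + t * t * A j j.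
  move=> s0 t0; have := cA (s *: delta_mx i 0 + t *: delta_mx j 0).
  have D k l : delta_mx 0 k *m A *m delta_mx l 0 = (A k l)%:M :> 'M_1.
    by rewrite -rowE -colE; apply/matrixP => a b; rewrite !mxE !ord1 mulr1n.
  have trE (B C : 'cV[R]_m) : (s *: B + t *: C)^T = s *: B^T + t *: C^T.
    by rewrite raddfD /= !linearZ.
  rewrite /qform trE !trmx_delta !(mulmxDl, mulmxDr).
  rewrite -!scalemxAl -!scalemxAr !D !mxE !mulr1n (sA j i).
  have -> : s * (s * A i i) + t * (s * A i j) + (s * (t * A i j) + t * (t * A j j))
     = s * s * A i i + 2 * s * t * A i j + t * t * A j j by ring.
  apply; apply/mxOverP => k l; rewrite !mxE nnegrE.
  by rewrite addr_ge0 // mulr_ge0.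
have Aii := E 1 0 ler01 (lexx _); have Ajj := E 0 1 (lexx _) ler01.
rewrite lt_neqAle; apply/andP; split; last by lra.
(* With [A i i = 0], this [s] and [t = 1] give the form the value [- A j j - 2], which is
   negative. *)
apply/eqP => Z; have s0 : 0 <= (A j j + 1) / (- A i j).
  by rewrite divr_ge0 //; lra.
have := E _ _ s0 ler01.
have -> : 2 * ((A j j + 1) / - A i j) * 1 * A i j = - 2 * (A j j + 1).
  by field; lra.
rewrite -Z; lra.
Qed.

(** [P] keeps the entries inside the fibres of [f]. There the off-diagonal entries are nonpositive,
    so passing from [x] to its absolute value does not increase the form, and copositivity makes
    each block psd. *)
Lemma spn_of_nonpos_blocks (R : realType) (m : nat) (A : 'M[R]_m)
    (I : finType) (f : 'I_m -> I) :
  copositive A ->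
  (forall i j, i != j -> f i = f j -> A i j <= 0) ->
  (forall i j, f i != f j -> 0 <= A i j) ->
  spn_matrix A.
Proof.
move=> [/symmetricmx_entryP sA cA] Ale0 Age0.
pose P : 'M[R]_m := \matrix_(i, j) if f i == f j then A i j else 0.
exists P, (A - P); split; last by rewrite addrC subrK.
- split; first by apply/symmetricmx_entryP => i j; rewrite !mxE eq_sym sA.
  move=> x.
  pose y c : 'cV[R]_m := \col_i if f i == c then `|x i 0| else 0.
  have y0 c : 0 <= qform A (y c).
    apply: cA; apply/mxOverP => i j; rewrite mxE nnegrE.
    by case: ifP => // _; apply: normr_ge0.
  apply: (@le_trans _ _ (\sum_c qform A (y c))); first exact: sumr_ge0.
  rewrite (eq_bigr _ (fun c _ => qformE A (y c))) qformE exchange_big /=.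
  apply: ler_sum => i _; rewrite exchange_big /=; apply: ler_sum => j _.
  (* For fixed [i], only the block [c = f i] contributes. *)
  rewrite (bigD1 (f i)) //= big1 ?addr0 => [|c /negPf nc]; last first.
    by rewrite mxE eq_sym nc !mul0r.
  rewrite !mxE eqxx [f j == _]eq_sym; case: eqP => [fij|_]; last first.
    by rewrite !mulr0 mul0r.
  have [->|nij] := eqVneq i j.
    by rewrite mulrAC [leRHS]mulrAC -normrM ger0_norm // -expr2 sqr_ge0.
  rewrite mulrAC [leRHS]mulrAC -normrM.
  by apply: ler_wnM2r; [exact: Ale0|exact: ler_norm].
- by apply/symmetricmx_entryP => i j; rewrite !mxE eq_sym sA.
- apply/mxOverP => i j; rewrite !mxE nnegrE.
  by case: eqP => [_|/eqP /Age0]; rewrite ?subrr ?subr0.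
Qed.

(** * Schur complements of a diagonal entry *)

Definition schur (R : realType) (m : nat) (A : 'M[R]_m.+1) (k : 'I_m.+1) :
    'M[R]_m :=
  \matrix_(i, j) (A (lift k i) (lift k j)
                  - A (lift k i) k * A k (lift k j) / A k k).

(** Brings a matrix indexed through [lift k] back to the size of [A], so that the two can be
    compared. *)
Definition extend0 (R : realType) (m : nat) (k : 'I_m.+1) (M : 'M[R]_m) :
    'M[R]_m.+1 :=
  \matrix_(i, j) if unlift k i is Some i' then
                   if unlift k j is Some j' then M i' j' else 0
                 else 0.

Lemma qform_extend0 (R : realType) (m : nat) (k : 'I_m.+1) (M : 'M[R]_m) x :
  qform (extend0 k M) x = qform M (\col_i x (lift k i) 0).
Proof.
rewrite !qformE (bigD1_ord k) //= big1 ?add0r => [|j _]; last first.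
  by rewrite mxE unlift_none mulr0 mul0r.
apply: eq_bigr => i _; rewrite (bigD1_ord k) //= [extend0 _ _ _ _]mxE liftK.
by rewrite unlift_none mulr0 mul0r add0r; apply: eq_bigr => j _; rewrite !mxE !liftK.
Qed.

Lemma schurE (R : realType) (m : nat) (A : 'M[R]_m.+1) (k : 'I_m.+1) :
  A k k != 0 ->
  A = (\matrix_(i, j) (A i k * A k j / A k k)) + extend0 k (schur A k).
Proof.
move=> Akk; apply/matrixP => i j; rewrite !mxE.
case: (unliftP k i) => [i' ->|->]; last by rewrite addr0 mulrAC divff // mul1r.
case: (unliftP k j) => [j' ->|->]; last by rewrite addr0 mulfK.
by rewrite !mxE addrC subrK.
Qed.

Lemma qform_rank1 (R : realType) (m : nat) (A : 'M[R]_m) (k : 'I_m)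
    (x : 'cV[R]_m) :
  A \is symmetricmx ->
  qform (\matrix_(i, j) (A i k * A k j / A k k)) x
    = (\sum_i A k i * x i 0) ^+ 2 / A k k.
Proof.
move=> /symmetricmx_entryP sA; rewrite qformE expr2 !mulr_suml.
apply: eq_bigr => i _; rewrite mulr_sumr mulr_suml.
by apply: eq_bigr => j _; rewrite mxE (sA i k); ring.
Qed.

Lemma schur_sym (R : realType) (m : nat) (A : 'M[R]_m.+1) (k : 'I_m.+1) :
  A \is symmetricmx -> schur A k \is symmetricmx.
Proof.
move=> /symmetricmx_entryP sA; apply/symmetricmx_entryP => i j; rewrite !mxE.
rewrite (sA (lift k i) (lift k j)) (sA (lift k i) k) (sA (lift k j) k).
by rewrite [A k _ * _]mulrC.
Qed.

(** A nonnegative [y] extends to an [x] on which the rank one part of [A] vanishes, so both forms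
    agree. The sign condition on row [k] makes the added coordinate nonnegative. *)
Lemma schur_copositive (R : realType) (m : nat) (A : 'M[R]_m.+1) (k : 'I_m.+1) :
  copositive A -> 0 < A k k -> (forall i, i != k -> A k i <= 0) ->
  copositive (schur A k).
Proof.
move=> [sA cA] Akk Ak; split; first exact: schur_sym.
move=> y /mxOverP y0.
(* The k-th coordinate is chosen to annihilate (A x)_k. *)
pose t := - (\sum_i A k (lift k i) * y i 0) / A k k.
pose x : 'cV[R]_m.+1 := \col_i if unlift k i is Some i' then y i' 0 else t.
have xl i : x (lift k i) 0 = y i 0 by rewrite mxE liftK.
have xk : A k k * x k 0 = - (\sum_i A k (lift k i) * y i 0).
  by rewrite mxE unlift_none mulrC divfK // lt0r_neq0.
have -> : qform (schur A k) y = qform A x.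
  rewrite {2}(schurE (lt0r_neq0 Akk)) qformD qform_rank1 // qform_extend0.
  rewrite (bigD1_ord k) //= (eq_bigr (fun i => A k (lift k i) * y i 0)) => [|i _];
    last by rewrite xl.
  rewrite xk addNr expr0n mul0r add0r.
  by congr qform; apply/matrixP => i j; rewrite ord1 [RHS]mxE xl.
apply: cA; apply/mxOverP => i j; rewrite mxE nnegrE.
case: (unliftP k i) => [i' _|_]; first by have := y0 i' 0; rewrite nnegrE.
rewrite divr_ge0 ?(ltW Akk) // oppr_ge0 sumr_le0 // => l _.
apply: mulr_le0_ge0; first by apply: Ak; rewrite eq_sym neq_lift.
by have := y0 l 0; rewrite nnegrE.
Qed.

(** The rank one part of [A] is psd because its form is a square divided by [A k k]; it joins the
    psd summand, and both summands are padded with zeros. *)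
Lemma spn_of_schur (R : realType) (m : nat) (A : 'M[R]_m.+1) (k : 'I_m.+1) :
  A \is symmetricmx -> 0 < A k k -> spn_matrix (schur A k) -> spn_matrix A.
Proof.
move=> sA Akk [P [N [[sP pP] sN /mxOverP pN E]]].
have sext (M : 'M[R]_m) : M \is symmetricmx -> extend0 k M \is symmetricmx.
  move=> /symmetricmx_entryP sM; apply/symmetricmx_entryP => i j; rewrite !mxE.
  by case: (unlift k i) => [?|]; case: (unlift k j) => [?|].
exists (\matrix_(i, j) (A i k * A k j / A k k) + extend0 k P), (extend0 k N).
split; last first.
- rewrite {1}(schurE (lt0r_neq0 Akk)) E -addrA; congr (_ + _).
  apply/matrixP => i j; rewrite !mxE.
  case: (unlift k i) => [?|]; case: (unlift k j) => [?|]; rewrite ?mxE ?addr0 //.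
- apply/mxOverP => i j; rewrite mxE nnegrE.
  case: (unlift k i) => [i'|//]; case: (unlift k j) => [j'|//].
  by have := pN i' j'; rewrite nnegrE.
- exact: sext.
split=> [|x]; last first.
  by rewrite qformD qform_rank1 // qform_extend0 addr_ge0 // divr_ge0 ?sqr_ge0 // ltW.
have /symmetricmx_entryP sA' := sA; have /symmetricmx_entryP sP' := sext _ sP.
apply/symmetricmx_entryP => i j; rewrite [LHS]mxE [RHS]mxE sP'; congr (_ + _).
by rewrite !mxE (sA' i k) (sA' k j) [A k i * _]mulrC.
Qed.

(** * The graph of the Schur complement *)

(* Vertices 0 and 1 of T_{n+1} come from the part of size 2, and the others from
   the remaining part after skipping w; the value at inr w is junk. *)
Definition T_label (n : nat) (w : 'I_n) (z : 'I_2 + 'I_n) : nat :=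
  match z with inl a => a | inr b => (unbump w b).+2 end.

Lemma T_label_lt (n : nat) (w : 'I_n) (z : 'I_2 + 'I_n) :
  z != inr w -> (T_label w z < n.+1)%N.
Proof.
case: z => [a _|b]; rewrite /T_label.
  (* The existence of [w] rules out [n = 0], so labels 0 and 1 are in range. *)
  by apply: (leq_trans (ltn_ord a)); case: n w => // -[].
have bn := ltn_ord b; have wn := ltn_ord w.
move=> /eqP bw; have {}bw : b <> w :> nat by move=> /val_inj E; apply: bw; rewrite E.
by rewrite /unbump; case: ltnP => ? /=; lia.
Qed.

Lemma T_label_inj (n : nat) (w : 'I_n) :
  {in [pred z | z != inr w] &, injective (T_label w)}.
Proof.
have side (b : 'I_n) : inr 'I_2 b != inr w -> b != w by apply: contraNneq => ->.
move=> [a|b] [a'|b'] /= zw z'w.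
- by move/val_inj ->.
- by move=> E; have := ltn_ord a; rewrite E.
- by move=> E; have := ltn_ord a'; rewrite -E.
- case=> E; congr inr; apply: val_inj.
  have /negPf bw := side _ zw; have /negPf b'w := side _ z'w.
  by apply: (can_in_inj (@unbumpK w)); rewrite ?inE //= ?bw ?b'w.
Qed.

(** The correction [A i k * A k j / A k k] is nonzero exactly when [i] and [j] both lie in the part
    of size 2. Off the diagonal [A i j = 0] there, so the base edge appears; every other
    off-diagonal entry is unchanged. *)
Lemma schur_graph_iso (R : realType) (m n : nat) (A : 'M[R]_m.+1)
    (h : 'I_m.+1 -> 'I_2 + 'I_n) (k : 'I_m.+1) (w : 'I_n) :
  bijective h ->
  (forall i j, complete_bipartite (h i) (h j) = mxgraph A i j) ->
  h k = inr w -> A k k != 0 ->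
  graph_iso (mxgraph (schur A k)) (@T_graph n.+1).
Proof.
move=> bh hA hk Akk; have ih := bij_inj bh.
have hw i : h (lift k i) != inr w.
  by rewrite -hk (inj_eq ih) eq_sym neq_lift.
pose g i : 'I_n.+1 := Ordinal (T_label_lt (hw i)).
have ig : injective g.
  move=> i j [] E; apply: (@lift_inj _ k); apply: ih.
  by apply: T_label_inj E; rewrite inE.
exists g; split.
  apply: inj_card_bij => //; rewrite !card_ord.
  by have := bij_eq_card bh; rewrite card_sum !card_ord => -[->].
move=> i j; rewrite /T_graph (inj_eq ig) /mxgraph.
have [//|nij] /= := eqVneq i j.
have nlij : lift k i != lift k j by rewrite (inj_eq lift_inj).
have e1 := hA (lift k i) (lift k j).
have e2 := hA (lift k i) k; have e3 := hA k (lift k j).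
move: e1 e2 e3 ig nij (hw i) (hw j).
rewrite /g /mxgraph nlij [lift k i == k]eq_sym !(negPf (neq_lift _ _)) mxE hk /=.
case: (h (lift k i)) => [a|b]; case: (h (lift k j)) => [a'|b'] /=.
- move=> /esym/negbFE/eqP -> /esym ik /esym kj _ _ _ _.
  by rewrite ltn_ord sub0r oppr_eq0 !mulf_neq0 ?invr_neq0.
- move=> /esym ij _ /esym/negbFE/eqP -> _ _ _ _.
  by rewrite ltn_ord mulr0 mul0r subr0 ij.
- move=> /esym ij /esym/negbFE/eqP -> _ _ _ _ _.
  by rewrite ltn_ord !mul0r subr0 ij.
- move=> /esym/negbFE/eqP -> /esym/negbFE/eqP -> _ _ _ _ _.
  by rewrite !mul0r subrr eqxx.
Qed.

(** * The two cases for the negative entries *)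

Theorem theorem2 (R : realType) (n : nat) (hn : (2 <= n)%N) :
  spn_graph R (@T_graph n.+1) -> spn_graph R (@complete_bipartite 2 n).
Proof.
move=> TS [|m] A cA [h [bh hA]].
  by have := bij_eq_card bh; rewrite card_sum !card_ord.
have [sA _] := cA; have /symmetricmx_entryP sA' := sA.
have [g hK gK] := bh; pose u := g (inl 0); pose v := g (inl 1).
have hu : h u = inl 0 by rewrite gK.
have hv : h v = inl 1 by rewrite gK.
have A0 i j : i != j -> ~~ complete_bipartite (h i) (h j) -> A i j = 0.
  by rewrite hA /mxgraph => -> /negbNE/eqP.
have uvw i : [\/ i = u, i = v | exists w, h i = inr w].
  case E: (h i) => [a|w]; last by constructor 3; exists w.
  by rewrite -(hK i) E; case: a E => [[|[|//]] lt2] _;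
    [constructor 1|constructor 2]; congr (g (inl _)); apply: val_inj.
have uv : u != v by rewrite (inj_eq (can_inj gK)).
have Auv : A u v = 0 by apply: A0 => //; rewrite hu hv.
have neq_wu w z : h w = inr z -> w != u.
  by move=> hw; apply: contra_eq_neq hw => ->; rewrite hu.
have neq_wv w z : h w = inr z -> w != v.
  by move=> hw; apply: contra_eq_neq hw => ->; rewrite hv.
have Aww i j y z : i != j -> h i = inr y -> h j = inr z -> A i j = 0.
  by move=> nij hi hj; apply: A0 => //; rewrite hi hj.
have [/existsP[k /andP[ku kv]]|neg] :=
  boolP [exists k, (A k u < 0) && (A k v < 0)].
  (* As [A u v = 0], a row negative at both [u] and [v] is neither of these two rows. *)
  have [z hz] : exists z, h k = inr z.
    case: (uvw k) => // E.
      by move: kv; rewrite E Auv ltxx.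
    by move: ku; rewrite E sA' Auv ltxx.
  have Akk := copositive_diag_gt0 cA ku.
  apply: (spn_of_schur sA Akk); apply: TS.
    apply: schur_copositive => // i nik.
    case: (uvw i) => [->|->|[y hy]]; [exact: ltW|exact: ltW|].
    by rewrite (Aww _ _ _ _ _ hz hy) // eq_sym.
  exact: schur_graph_iso bh hA hz (lt0r_neq0 Akk).
(* [f] sends a vertex to the centre of its star, or to itself if it lies in neither star. Testing
   [u] first loses nothing, since [neg] forbids a vertex in both stars. *)
pose f i := if (i == u) || (A u i < 0) then u
            else if (i == v) || (A v i < 0) then v else i.
have fu : f u = u by rewrite /f eqxx.
have fv : f v = v by rewrite /f eqxx Auv ltxx orbF eq_sym (negPf uv).
have fwu w z : h w = inr z -> (f w == u) = (A u w < 0).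
  move=> hw; rewrite /f (negPf (neq_wu _ _ hw)) (negPf (neq_wv _ _ hw)) /=.
  case: ifP => _; rewrite ?eqxx //; case: ifP => _; first by rewrite eq_sym (negPf uv).
  exact: negbTE (neq_wu _ _ hw).
have fwv w z : h w = inr z -> (f w == v) = (A v w < 0).
  move=> hw; rewrite /f (negPf (neq_wu _ _ hw)) (negPf (neq_wv _ _ hw)) /=.
  case: ifP => [Au|_].
    rewrite (negPf uv); apply/esym/negbTE; apply: contra neg => Av.
    by apply/existsP; exists w; rewrite !(sA' w) Au.
  case: ifP => _; rewrite ?eqxx //; exact: negbTE (neq_wv _ _ hw).
(* Zero entries are set apart because two leaves of one star share a label while their entry is 0,
   which suits both sign conditions. *)
have key i j : i != j -> A i j != 0 -> (f i == f j) = (A i j < 0).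
  case: (uvw i) => [->|->|[y hy]]; case: (uvw j) => [->|->|[z hz]];
    rewrite ?eqxx ?Auv ?[A v u]sA' ?Auv ?eqxx // => nij Aij.
  - by rewrite fu eq_sym (fwu _ _ hz).
  - by rewrite fv eq_sym (fwv _ _ hz).
  - by rewrite fu (fwu _ _ hy) sA'.
  - by rewrite fv (fwv _ _ hy) sA'.
  - by rewrite (Aww _ _ _ _ nij hy hz) eqxx in Aij.
apply: (@spn_of_nonpos_blocks _ _ _ _ f) => // i j.
  move=> nij /eqP fij; have [->//|Aij] := eqVneq (A i j) 0.
  by rewrite (key _ _ nij Aij) in fij; apply: ltW.
move=> fij; have [->//|Aij] := eqVneq (A i j) 0.
have nij : i != j by apply: contraNneq fij => ->.
by rewrite (key _ _ nij Aij) -leNgt in fij.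
Qed.
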